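(* For every real $\nu$ with $|\nu|<1$, the derivative of $g_\nu(u)=K_\nu'(u)/K_\nu(u)^2$ is positive for all sufficiently small $u>0$ and negative for all sufficiently large $u$. Consequently $g_\nu$ has no global monotonicity on $(0,\infty)$, i.e. it is neither nondecreasing nor nonincreasing there.
   Context: $K_\nu$ is the modified Bessel function of the second kind of order $\nu$, with the standard normalization: $K_\nu(u)>0$ for $u>0$, $K_{-\nu}=K_\nu$, $K_\nu$ solves $u^2w''+uw'-(u^2+\nu^2)w=0$, and $K_\nu(u)\sim(\pi/(2u))^{1/2}e^{-u}$ as $u\to\infty$. The prime denotes the derivative in $u$. *)

(* Defs.v *)
From Stdlib Require Import Reals.
From Coquelicot Require Import Coquelicot.
Open Scope R_scope.

(* [w] is a twice differentiable solution on (0, +oo) of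
   u^2 w'' + u w' - (u^2 + nu^2) w = 0.  Differentiability is required
   explicitly because [Derive] is total. *)
Definition solves_modified_bessel (nu : R) (w : R -> R) : Prop :=
  forall u, 0 < u ->
    ex_derive w u /\ ex_derive (Derive w) u /\
    u ^ 2 * Derive (Derive w) u + u * Derive w u - (u ^ 2 + nu ^ 2) * w u = 0.

(* [K nu u] is K_nu(u).  Only the values at u > 0 are constrained, and there the
   equation and the asymptotics determine K: two solutions of the equation with
   these asymptotics differ by a solution that is o(e^(-u) / sqrt u), hence zero. *)
Record is_besselK (K : R -> R -> R) : Prop := {
  besselK_pos : forall nu u, 0 < u -> 0 < K nu u;
  besselK_even : forall nu u, 0 < u -> K (- nu) u = K nu u;
  besselK_ode : forall nu, solves_modified_bessel nu (K nu);
  besselK_asymp : forall nu,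
    is_lim (fun u => K nu u / (sqrt (PI / (2 * u)) * exp (- u))) p_infty 1
}.

Definition besselK_quotient (K : R -> R -> R) (nu u : R) : R :=
  Derive (K nu) u / (K nu u) ^ 2.

Definition nondecreasing_on_pos (f : R -> R) : Prop :=
  forall x y, 0 < x -> x <= y -> f x <= f y.

Definition nonincreasing_on_pos (f : R -> R) : Prop :=
  forall x y, 0 < x -> x <= y -> f y <= f x.

(* Main.v *)
Require Import Defs.
From Stdlib Require Import Reals Lra Classical.
From Coquelicot Require Import Coquelicot.
Open Scope R_scope.

(** Write K for K_nu and p(u) = - u K'(u) / K(u).  Eliminating K'' with the
    equation gives

      g'(u) = (u^2 + nu^2 + p - 2 p^2) / (u^2 K(u)),

    so only the size of p matters.

    For large u, the function u e^(-u) (K + K') is increasing by the equation.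
    If K + K' = e^(-u) (e^u K)' were positive somewhere it would remain positive,
    and e^u K would stay away from 0, against the prescribed asymptotics.  Hence
    K + K' <= 0 everywhere, that is p >= u ([besselK_derive_le]), and then -2 p^2
    dominates the numerator as soon as u > 2.

    For small u, p solves the Riccati equation u p' = p^2 - u^2 - nu^2.  Followed
    towards u = 0, its positive solutions are attracted by |nu|: for each
    a > |nu|, if p > a held for all small u, the right-hand side would exceed a
    positive constant there and p would fall to minus infinity at least as fast as
    a multiple of ln u, whereas p > 0.  So p <= a at some point, and from there
    down to 0 ([log_slope_le_near_0]).  The polynomial nu^2 + p - 2 p^2 is concave
    and nonnegative at 0, so it is positive on (0, a] provided it is positive at a.
    Since |nu| < 1 it is positive at |nu|, or just to the right of 0 when nu = 0,
    so a suitable a > |nu| exists. *)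

(** * Monotonicity from the sign of the derivative *)

Lemma incr_of_derive_pos (f df : R -> R) (a b x y : R) :
  (forall u, a < u < b -> is_derive f u (df u)) ->
  (forall u, a < u < b -> 0 < df u) ->
  a < x -> x < y -> y < b -> f x < f y.
Proof.
  intros Hd Hp Hx Hxy Hy.
  apply (incr_function f a b df); simpl; auto.
  intros u Ha Hb. apply Rlt_gt. auto.
Qed.

Lemma decr_of_derive_neg (f df : R -> R) (a b x y : R) :
  (forall u, a < u < b -> is_derive f u (df u)) ->
  (forall u, a < u < b -> df u < 0) ->
  a < x -> x < y -> y < b -> f y < f x.
Proof.
  intros Hd Hn Hx Hxy Hy.
  apply Ropp_lt_cancel.
  apply (incr_of_derive_pos (fun u => - f u) (fun u => - df u) a b); auto.
  - intros u Hu. apply (is_derive_opp f u (df u)). auto.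
  - intros u Hu. specialize (Hn u Hu). lra.
Qed.

(** * The equation in solved form *)

Lemma solves_is_derive (nu : R) (w : R -> R) (u : R) :
  solves_modified_bessel nu w -> 0 < u -> is_derive w u (Derive w u).
Proof.
  intros H Hu. apply Derive_correct, (H u Hu).
Qed.

Lemma solves_is_derive2 (nu : R) (w : R -> R) (u : R) :
  solves_modified_bessel nu w -> 0 < u ->
  is_derive (Derive w) u ((1 + nu ^ 2 / u ^ 2) * w u - Derive w u / u).
Proof.
  intros H Hu. destruct (H u Hu) as (_ & H2 & E).
  apply Derive_correct in H2.
  replace ((1 + nu ^ 2 / u ^ 2) * w u - Derive w u / u)
    with (Derive (Derive w) u); [exact H2|].
  apply (Rmult_eq_reg_l (u ^ 2)); [|apply pow_nonzero; lra].
  transitivity ((u ^ 2 + nu ^ 2) * w u - u * Derive w u); [lra|].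
  field. lra.
Qed.

(** * The logarithmic derivative is at most -1 *)

Lemma exp_mul_besselK_small (K : R -> R -> R) (HK : is_besselK K)
    (nu u0 eps : R) :
  0 < eps -> exists u, u0 < u /\ 0 < u /\ exp u * K nu u < eps.
Proof.
  intros He.
  destruct (proj2 (is_lim_spec _ _ _) (besselK_asymp K HK nu) (mkposreal 1 Rlt_0_1))
    as [M HM]; simpl in HM.
  (* beyond B, 2 sqrt (PI / (2 u)) < eps, while e^u K < 2 sqrt (PI / (2 u))
     beyond M *)
  set (B := 2 * PI / eps ^ 2).
  set (u := Rmax (Rmax u0 M) (Rmax 0 B) + 1).
  assert (Hu : u0 < u /\ M < u /\ 0 < u /\ B < u).
  { unfold u.
    generalize (Rmax_l (Rmax u0 M) (Rmax 0 B)) (Rmax_r (Rmax u0 M) (Rmax 0 B))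
      (Rmax_l u0 M) (Rmax_r u0 M) (Rmax_l 0 B) (Rmax_r 0 B). lra. }
  destruct Hu as (H0 & HMu & Hpos & HB).
  exists u. repeat split; auto.
  specialize (HM u HMu). apply Rabs_def2 in HM. destruct HM as [HM _].
  set (s := sqrt (PI / (2 * u))) in *.
  assert (Hpi := PI_RGT_0).
  assert (He2 : 0 < eps ^ 2) by (apply pow_lt; lra).
  assert (Hq : 0 < PI / (2 * u)) by (apply Rdiv_lt_0_compat; lra).
  assert (Hs : 0 < s) by (apply sqrt_lt_R0; auto).
  assert (Hs2 : s < eps / 2).
  { rewrite <- (sqrt_pow2 (eps / 2)) by lra.
    apply sqrt_lt_1_alt. split; [lra|].
    apply (Rmult_lt_reg_r (2 * u)); [lra|].
    replace (PI / (2 * u) * (2 * u)) with PI by (field; lra).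
    assert (B * eps ^ 2 < u * eps ^ 2) as H by (apply Rmult_lt_compat_r; auto).
    replace (B * eps ^ 2) with (2 * PI) in H by (unfold B; field; lra).
    lra. }
  assert (Hex := exp_pos u).
  replace (K nu u / (s * exp (- u))) with (exp u * K nu u / s) in HM
    by (rewrite exp_Ropp; field; split; lra).
  assert (exp u * K nu u < 2 * s).
  { replace (exp u * K nu u) with (exp u * K nu u / s * s) by (field; lra).
    apply Rmult_lt_compat_r; lra. }
  lra.
Qed.

(** The equation gives [(u e^(-u) (K + K'))' = e^(-u) (1 + nu^2/u) K > 0].  So if
    [K + K'] were positive at [u] it would remain so, and [e^u K], whose derivative
    is [e^u (K + K')], would increase from there on and could not tend to 0. *)
Lemma besselK_derive_le (K : R -> R -> R) (HK : is_besselK K) (nu u : R) :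
  0 < u -> Derive (K nu) u <= - K nu u.
Proof.
  intros Hu.
  destruct (Rle_lt_dec (Derive (K nu) u) (- K nu u)) as [|Hlt]; [assumption|].
  exfalso.
  assert (Hode := besselK_ode K HK nu).
  assert (Hpos := besselK_pos K HK nu).
  set (phi := fun x => x * exp (- x) * (K nu x + Derive (K nu) x)).
  assert (Hphi : forall x y, 0 < x -> x < y -> phi x < phi y).
  { intros x y Hx Hxy.
    apply (incr_of_derive_pos phi
      (fun t => exp (- t) * (1 + nu ^ 2 / t) * K nu t) 0 (y + 1)); try lra.
    - intros t Ht. unfold phi.
      assert (D1 := solves_is_derive nu _ t Hode (proj1 Ht)).
      assert (D2 := solves_is_derive2 nu _ t Hode (proj1 Ht)).
      auto_derive.
      + repeat split; eexists; eassumption.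
      + change (Derive (fun x => K nu x) t) with (Derive (K nu) t).
        rewrite (is_derive_unique (fun x : R => Derive (K nu) x) _ _ D2).
        field. lra.
    - intros t Ht.
      assert (0 <= nu ^ 2 / t)
        by (apply Rdiv_le_0_compat; [apply pow2_ge_0|lra]).
      apply Rmult_lt_0_compat; [apply Rmult_lt_0_compat|apply Hpos; lra].
      + apply exp_pos.
      + lra. }
  assert (Hsum : forall x, u <= x -> 0 < K nu x + Derive (K nu) x).
  { intros x [Hx|<-]; [|lra].
    assert (H := Hphi u x Hu Hx). unfold phi in H.
    assert (0 < u * exp (- u) * (K nu u + Derive (K nu) u)).
    { apply Rmult_lt_0_compat; [apply Rmult_lt_0_compat|]; try lra. apply exp_pos. }
    apply (Rmult_lt_reg_l (x * exp (- x))); [|lra].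
    apply Rmult_lt_0_compat; [lra|apply exp_pos]. }
  destruct (exp_mul_besselK_small K HK nu (u + 1) (exp (u + 1) * K nu (u + 1)))
    as (y & Hy & _ & Hsmall).
  { apply Rmult_lt_0_compat; [apply exp_pos|apply Hpos; lra]. }
  assert (exp (u + 1) * K nu (u + 1) < exp y * K nu y); [|lra].
  apply (incr_of_derive_pos (fun x => exp x * K nu x)
    (fun x => exp x * (K nu x + Derive (K nu) x)) u (y + 1)); try lra.
  - intros x Hx.
    assert (D1 := solves_is_derive nu _ x Hode ltac:(lra)).
    auto_derive.
    + repeat split; eexists; eassumption.
    + change (Derive (fun x => K nu x) x) with (Derive (K nu) x). ring.
  - intros x Hx. apply Rmult_lt_0_compat; [apply exp_pos|apply Hsum; lra].
Qed.

(** * The Riccati equation near the origin *)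

Definition log_slope (w : R -> R) (u : R) : R := - (u * Derive w u) / w u.

Lemma log_slope_riccati (nu : R) (w : R -> R) (u : R) :
  solves_modified_bessel nu w -> 0 < u -> 0 < w u ->
  is_derive (log_slope w) u ((log_slope w u ^ 2 - u ^ 2 - nu ^ 2) / u).
Proof.
  intros Hode Hu Hw.
  assert (D1 := solves_is_derive nu _ u Hode Hu).
  assert (D2 := solves_is_derive2 nu _ u Hode Hu).
  unfold log_slope. auto_derive.
  - repeat split; try (eexists; eassumption). lra.
  - change (Derive (fun x => w x) u) with (Derive w u).
    rewrite (is_derive_unique (fun x : R => Derive w x) _ _ D2).
    field. lra.
Qed.

Lemma log_slope_besselK_ge (K : R -> R -> R) (HK : is_besselK K) (nu u : R) :
  0 < u -> u <= log_slope (K nu) u.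
Proof.
  intros Hu.
  assert (HKp := besselK_pos K HK nu u Hu).
  assert (H := besselK_derive_le K HK nu u Hu).
  unfold log_slope. apply Rle_div_r; [lra|]. nra.
Qed.

(** While [p > a], the Riccati equation gives [u p' >= delta > 0], so that
    [p - delta ln u] increases and [p] is driven below 0 near the origin. *)
Lemma log_slope_le_somewhere (nu a d : R) (w : R -> R) :
  solves_modified_bessel nu w -> (forall u, 0 < u -> 0 < w u) ->
  (forall u, 0 < u -> 0 < log_slope w u) ->
  0 < a -> 0 < d -> d ^ 2 + nu ^ 2 < a ^ 2 ->
  exists u, 0 < u < d /\ log_slope w u <= a.
Proof.
  intros Hode Hw Hp Ha Hd Had.
  set (p := log_slope w) in *.
  set (delta := a ^ 2 - nu ^ 2 - d ^ 2).
  assert (Hdelta : 0 < delta) by (unfold delta; lra).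
  set (x := d / 2).
  set (u := x * exp (- (p x / delta))).
  assert (Hx : 0 < x < d) by (unfold x; lra).
  assert (Hpx : 0 < p x) by (apply Hp; lra).
  assert (Hq : 0 < p x / delta) by (apply Rdiv_lt_0_compat; lra).
  assert (He : exp (- (p x / delta)) < 1).
  { rewrite <- exp_0. apply exp_increasing. lra. }
  assert (He0 := exp_pos (- (p x / delta))).
  assert (Hux : u < x) by (unfold u; nra).
  assert (Hu : 0 < u) by (unfold u; nra).
  destruct (Rle_lt_dec (p x) a) as [|Hpxa]; [exists x; auto|].
  assert (Hcase : (exists v, 0 < v < d /\ p v <= a) \/
                  (forall v, 0 < v < d -> a < p v)).
  { destruct (classic (exists v, 0 < v < d /\ p v <= a)) as [E|E];
      [left; exact E|right].
    intros v Hv. apply Rnot_le_lt. intros Hle. apply E. exists v. auto. }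
  destruct Hcase as [|Hall]; [assumption|exfalso].
  assert (Hlt : p u - delta * ln u < p x - delta * ln x).
  { apply (incr_of_derive_pos (fun t => p t - delta * ln t)
      (fun t => (p t ^ 2 - t ^ 2 - nu ^ 2) / t - delta * / t) 0 d); try lra.
    - intros t Ht.
      apply (is_derive_minus p (fun t => delta * ln t)).
      + apply log_slope_riccati; auto; try lra. apply Hw; lra.
      + auto_derive; [lra|]. ring.
    - intros t Ht.
      replace ((p t ^ 2 - t ^ 2 - nu ^ 2) / t - delta * / t)
        with ((p t ^ 2 - t ^ 2 - nu ^ 2 - delta) / t) by (field; lra).
      assert (Hpt := Hall t Ht).
      apply Rdiv_lt_0_compat; [|lra]. unfold delta. nra. }
  (* u was chosen so that delta (ln x - ln u) = p x, forcing p u < 0 *)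
  assert (Hln : delta * ln u = delta * ln x - p x).
  { unfold u. rewrite ln_mult, ln_exp by lra. field. lra. }
  assert (0 < p u) by (apply Hp; lra).
  lra.
Qed.

(** With [theta = u d/du] the equation reads
    [(theta - a) (theta + a) w = (u^2 + nu^2 - a^2) w], so that
    [u^(-a) (theta + a) w] decreases on [(0, d)]; and [p <= a] says exactly that
    it is nonnegative. *)
Lemma log_slope_le_backward (nu a d : R) (w : R -> R) (x y : R) :
  solves_modified_bessel nu w -> (forall u, 0 < u -> 0 < w u) ->
  d ^ 2 + nu ^ 2 < a ^ 2 ->
  0 < x -> x < y -> y < d -> log_slope w y <= a -> log_slope w x <= a.
Proof.
  intros Hode Hw Had Hx Hxy Hy Hpy.
  set (psi := fun u => exp (- a * ln u) * (a * w u + u * Derive w u)).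
  assert (Hpsi : psi y < psi x).
  { apply (decr_of_derive_neg psi
      (fun u => exp (- a * ln u) * ((u ^ 2 + nu ^ 2 - a ^ 2) * w u / u)) 0 d); auto.
    - intros u Hu. unfold psi.
      assert (D1 := solves_is_derive nu _ u Hode (proj1 Hu)).
      assert (D2 := solves_is_derive2 nu _ u Hode (proj1 Hu)).
      auto_derive.
      + repeat split; try (eexists; eassumption). lra.
      + change (Derive (fun x => w x) u) with (Derive w u).
        rewrite (is_derive_unique (fun x : R => Derive w x) _ _ D2).
        field. lra.
    - intros u Hu.
      assert (Hwu := Hw u (proj1 Hu)).
      assert (He := exp_pos (- a * ln u)).
      assert (0 < (a ^ 2 - u ^ 2 - nu ^ 2) * w u / u).
      { apply Rdiv_lt_0_compat; [|lra]. apply Rmult_lt_0_compat; nra. }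
      replace ((u ^ 2 + nu ^ 2 - a ^ 2) * w u / u)
        with (- ((a ^ 2 - u ^ 2 - nu ^ 2) * w u / u)) by (field; lra).
      nra. }
  assert (Hwx := Hw x Hx). assert (Hwy := Hw y ltac:(lra)).
  assert (Ey := exp_pos (- a * ln y)). assert (Ex := exp_pos (- a * ln x)).
  unfold log_slope in *.
  apply Rle_div_l in Hpy; [|lra]. apply Rle_div_l; [lra|].
  unfold psi in Hpsi.
  assert (0 <= exp (- a * ln y) * (a * w y + y * Derive w y))
    by (apply Rmult_le_pos; lra).
  assert (0 < a * w x + x * Derive w x); [|lra].
  apply (Rmult_lt_reg_l (exp (- a * ln x))); lra.
Qed.

Lemma log_slope_le_near_0 (nu a : R) (w : R -> R) :
  solves_modified_bessel nu w -> (forall u, 0 < u -> 0 < w u) ->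
  (forall u, 0 < u -> 0 < log_slope w u) -> Rabs nu < a ->
  exists d, 0 < d /\ forall u, 0 < u < d -> log_slope w u <= a.
Proof.
  intros Hode Hw Hp Ha.
  assert (Hm := Rabs_pos nu).
  assert (Hm2 : Rabs nu ^ 2 = nu ^ 2) by apply pow2_abs.
  (* (a - |nu|)^2 < a^2 - |nu|^2 only when nu <> 0, hence the half *)
  set (d := (a - Rabs nu) / 2).
  assert (Hd : 0 < d) by (unfold d; lra).
  assert (Had : d ^ 2 + nu ^ 2 < a ^ 2) by (rewrite <- Hm2; unfold d; nra).
  destruct (log_slope_le_somewhere nu a d w) as (y & Hy & Hpy); auto; [lra|].
  exists y. split; [lra|]. intros u Hu.
  apply (log_slope_le_backward nu a d w u y); auto; lra.
Qed.

(** * The derivative of the quotient *)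

Lemma besselK_quotient_is_derive (K : R -> R -> R) (HK : is_besselK K)
    (nu u : R) :
  0 < u ->
  is_derive (besselK_quotient K nu) u
    ((u ^ 2 + nu ^ 2 + log_slope (K nu) u - 2 * log_slope (K nu) u ^ 2)
       / (u ^ 2 * K nu u)).
Proof.
  intros Hu.
  assert (Hode := besselK_ode K HK nu).
  assert (HKp := besselK_pos K HK nu u Hu).
  assert (D1 := solves_is_derive nu _ u Hode Hu).
  assert (D2 := solves_is_derive2 nu _ u Hode Hu).
  unfold besselK_quotient, log_slope. auto_derive.
  - repeat split; try (eexists; eassumption).
    apply Rgt_not_eq. nra.
  - change (Derive (fun x => K nu x) u) with (Derive (K nu) u).
    rewrite (is_derive_unique (fun x : R => Derive (K nu) x) _ _ D2).
    field. lra.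
Qed.

Theorem proposition5p1 (K : R -> R -> R) (HK : is_besselK K)
    (nu : R) (Hnu : Rabs nu < 1) :
  (exists d : R, 0 < d /\ forall u : R, 0 < u < d ->
     ex_derive (besselK_quotient K nu) u /\ 0 < Derive (besselK_quotient K nu) u) /\
  (exists M : R, forall u : R, M < u ->
     ex_derive (besselK_quotient K nu) u /\ Derive (besselK_quotient K nu) u < 0) /\
  ~ nondecreasing_on_pos (besselK_quotient K nu) /\
  ~ nonincreasing_on_pos (besselK_quotient K nu).
Proof.
  assert (HKp := besselK_pos K HK nu).
  assert (Hm := Rabs_pos nu).
  assert (Hm2 : Rabs nu ^ 2 = nu ^ 2) by apply pow2_abs.
  assert (HD := besselK_quotient_is_derive K HK nu).
  assert (Hge := log_slope_besselK_ge K HK nu).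
  set (p := log_slope (K nu)) in *.
  set (g := besselK_quotient K nu) in *.
  set (dg := fun u => (u ^ 2 + nu ^ 2 + p u - 2 * p u ^ 2) / (u ^ 2 * K nu u)).
  assert (Hden : forall u, 0 < u -> 0 < u ^ 2 * K nu u).
  { intros u Hu. apply Rmult_lt_0_compat; [apply pow_lt; lra|auto]. }
  assert (Hsmall : exists d, 0 < d /\ forall u, 0 < u < d -> 0 < dg u).
  { set (m := Rabs nu) in *.
    (* at a = m + (1 - m) / 4, m^2 + a - 2 a^2 equals (1 - m^2) / 8 > 0 *)
    set (a := (1 + 3 * m) / 4).
    destruct (log_slope_le_near_0 nu a (K nu)) as (d & Hd & Hpd).
    - apply (besselK_ode K HK).
    - exact HKp.
    - intros u Hu. specialize (Hge u Hu). fold p. lra.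
    - fold m. unfold a. lra.
    - fold p in Hpd. exists d. split; [exact Hd|]. intros u Hu.
      specialize (Hpd u Hu). specialize (Hge u (proj1 Hu)).
      unfold dg. apply Rdiv_lt_0_compat; [|apply Hden; lra].
      assert (Ha : 0 < m ^ 2 + a - 2 * a ^ 2) by (unfold a; nra).
      assert (Ha0 : 0 < a) by (unfold a; lra).
      rewrite <- Hm2.
      (* concavity in p, compared with the chord between 0 and a *)
      assert (0 < a * (m ^ 2 + p u - 2 * p u ^ 2)).
      { replace (a * (m ^ 2 + p u - 2 * p u ^ 2))
          with (p u * (m ^ 2 + a - 2 * a ^ 2) + (a - p u) * (m ^ 2 + 2 * a * p u))
          by ring.
        assert (0 < p u * (m ^ 2 + a - 2 * a ^ 2)) by (apply Rmult_lt_0_compat; lra).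
        assert (0 <= (a - p u) * (m ^ 2 + 2 * a * p u))
          by (apply Rmult_le_pos; nra).
        lra. }
      assert (0 < u ^ 2) by (apply pow_lt; lra).
      assert (0 < m ^ 2 + p u - 2 * p u ^ 2)
        by (apply (Rmult_lt_reg_l a); lra).
      lra. }
  assert (Hlarge : forall u, 2 < u -> dg u < 0).
  { intros u Hu. specialize (Hge u ltac:(lra)).
    unfold dg. apply Rdiv_neg_pos; [|apply Hden; lra].
    assert (nu ^ 2 < 1) by (rewrite <- Hm2; nra).
    nra. }
  destruct Hsmall as (d & Hd & Hsmall).
  repeat split.
  - exists d. split; [exact Hd|]. intros u Hu. split.
    + exists (dg u). apply HD; lra.
    + rewrite (is_derive_unique g u (dg u)); [auto|apply HD; lra].
  - exists 2. intros u Hu. split.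
    + exists (dg u). apply HD; lra.
    + rewrite (is_derive_unique g u (dg u)); [auto|apply HD; lra].
  - intros H. specialize (H 3 4 ltac:(lra) ltac:(lra)).
    assert (g 4 < g 3); [|lra].
    apply (decr_of_derive_neg g dg 2 5); try lra.
    + intros u Hu. apply HD; lra.
    + intros u Hu. apply Hlarge; lra.
  - intros H. specialize (H (d / 3) (d / 2) ltac:(lra) ltac:(lra)).
    assert (g (d / 3) < g (d / 2)); [|lra].
    apply (incr_of_derive_pos g dg 0 d); try lra.
    + intros u Hu. apply HD; lra.
    + exact Hsmall.
Qed.
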